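(* Let $G$ be a totally disconnected locally compact group, $\phi:G\to G$ a topological automorphism and $N$ a closed normal subgroup of $G$ such that $\phi(N)=N$, and let $\overline\phi:G/N\to G/N$ be the topological automorphism induced by $\phi$. Then: (a) $C(\phi\restriction_N,U\cap N)=C(\phi,U)\cap N$ for every $U\in\mathcal B(G)$, and $h_{top}(\phi)\geq h_{top}(\phi\restriction_N)$; (b) $C(\overline\phi,q(U))=q(C(\phi,U))$ for every $U\in\mathcal B(G)$ such that $N\subseteq U$, where $q:G\to G/N$ is the canonical projection; moreover, $h_{top}(\phi)\geq h_{top}(\overline\phi)$.
   Context: For a totally disconnected locally compact group $G$, $\mathcal B(G)$ denotes the family of all open compact subgroups of $G$. A topological automorphism is a group automorphism that is a homeomorphism. For a continuous endomorphism $\psi:G\to G$, $U\in\mathcal B(G)$ and an integer $n\ge 1$, put $$C_n(\psi,U)=U\cap\psi^{-1}(U)\cap\ldots\cap\psi^{-n+1}(U),\qquad C(\psi,U)=\bigcap_{n=0}^\infty\psi^{-n}(U).$$ The index $[U:C_n(\psi,U)]$ is finite. The topological entropy of $\psi$ with respect to $U$ is $H_{top}(\psi,U)=\lim_{n\to\infty}\frac{\log[U:C_n(\psi,U)]}{n}$ (the limit exists), and the topological entropy of $\psi$ is $h_{top}(\psi)=\sup\{H_{top}(\psi,U):U\in\mathcal B(G)\}\in[0,\infty]$. The groups $N$ (with the subspace topology) and $G/N$ (with the quotient topology) are again totally disconnected locally compact groups, and the same definitions apply to $\phi\restriction_N:N\to N$ and $\overline\phi$. *)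

(* Defs.v *)
From HB Require Import structures.
From mathcomp Require Import all_boot all_order all_algebra generic_quotient.
From mathcomp Require Import finmap.
From mathcomp Require Import all_classical all_reals all_analysis.

Set Implicit Arguments.
Unset Strict Implicit.
Unset Printing Implicit Defensive.

Import numFieldNormedType.Exports.

Local Open Scope classical_set_scope.
Local Open Scope group_scope.

HB.mixin Record isTopologicalGroup G of Group G & Topological G := {
  mulg_continuous : continuous (fun x : G * G => x.1 * x.2) ;
  invg_continuous : continuous (fun x : G => x^-1)
}.

#[short(type="topGroupType")]
HB.structure Definition TopologicalGroup :=
  {G of Group G & Topological G & isTopologicalGroup G}.

(* No separation axiom is needed: total disconnectedness makes points closed, *)
(* so that G is Hausdorff.                                                    *)
Definition tdlc (G : topGroupType) : Prop :=
  totally_disconnected [set: G] /\ locally_compact [set: G].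

Definition subgroup (G : groupType) (A : set G) : Prop :=
  group_closed [in A].

Record normalSubgroup (G : groupType) := NormalSubgroup {
  nsg_set :> set G ;
  nsg_subgroup : subgroup nsg_set ;
  nsg_normal : forall x g, nsg_set x -> nsg_set (x ^ g)
}.

Section NormalSubgroupTheory.
Variables (G : groupType) (N : normalSubgroup G).

Lemma nsg1 : nsg_set N 1.
Proof. by have [/set_mem] := nsg_subgroup N. Qed.

Lemma nsgF x y : nsg_set N x -> nsg_set N y -> nsg_set N (x / y).
Proof.
move=> /mem_set Nx /mem_set Ny; apply/set_mem.
by have [_] := nsg_subgroup N; apply.
Qed.

Lemma nsgV x : nsg_set N x -> nsg_set N x^-1.
Proof. by move=> Nx; rewrite -[x^-1]mul1g; apply: nsgF => //; exact: nsg1. Qed.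

Lemma nsgM x y : nsg_set N x -> nsg_set N y -> nsg_set N (x * y).
Proof. by move=> Nx Ny; rewrite -[y]invgK; apply: nsgF => //; exact: nsgV. Qed.

Definition same_coset (x y : G) : bool := (x^-1 * y) \in (N : set G).

Lemma same_cosetP x y : reflect (nsg_set N (x^-1 * y)) (same_coset x y).
Proof. by apply: (iffP idP) => [/set_mem|/mem_set]. Qed.

Lemma same_coset_refl : reflexive same_coset.
Proof. by move=> x; apply/same_cosetP; rewrite mulVg; exact: nsg1. Qed.

Lemma same_coset_sym : symmetric same_coset.
Proof.
by move=> x y; apply/same_cosetP/same_cosetP => /nsgV; rewrite invgM invgK.
Qed.

Lemma same_coset_trans : transitive same_coset.
Proof.
move=> y x z /same_cosetP xy /same_cosetP yz; apply/same_cosetP.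
by have := nsgM xy yz; rewrite mulgA -(mulgA x^-1) mulgV mulg1.
Qed.

Canonical same_coset_equiv :=
  EquivRel same_coset same_coset_refl same_coset_sym same_coset_trans.

End NormalSubgroupTheory.

Definition subgroupT (G : topGroupType) (N : normalSubgroup G) : Type :=
  set_type N.

Section SubgroupTopGroup.
Variables (G : topGroupType) (N : normalSubgroup G).
Local Notation T := (subgroupT N).

HB.instance Definition _ := SubType.copy T (set_type N).
HB.instance Definition _ := Topological.copy T (set_type N).
HB.instance Definition _ :=
  SubChoice_isSubGroup.Build G [in (N : set G)] T (nsg_subgroup N).

Lemma subgroup_val_continuous : continuous (\val : T -> G).
Proof. exact: initial_continuous. Qed.

Lemma subgroup_continuous (X : topologicalType) (f : X -> T) :
  continuous (\val \o f) -> continuous f.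
Proof.
move=> /continuousP cf; apply/continuousP => _ [W oW <-].
by rewrite -comp_preimage; exact: cf.
Qed.

Lemma subgroup_mul_continuous : continuous (fun x : T * T => x.1 * x.2).
Proof.
apply: subgroup_continuous => x /=.
apply: (@cvg_comp _ _ _ (fun y : T * T => (\val y.1, \val y.2))
  (fun z : G * G => z.1 * z.2) _ (nbhs (\val x.1, \val x.2))); last first.
  exact: (@mulg_continuous G (\val x.1, \val x.2)).
apply: cvg_pair.
- apply: (@cvg_comp _ _ _ fst (\val : T -> G) _ (nbhs x.1)); first exact: cvg_fst.
  exact: subgroup_val_continuous.
- apply: (@cvg_comp _ _ _ snd (\val : T -> G) _ (nbhs x.2)); first exact: cvg_snd.
  exact: subgroup_val_continuous.
Qed.

Lemma subgroup_inv_continuous : continuous (fun x : T => x^-1).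
Proof.
apply: subgroup_continuous => x.
rewrite (_ : _ \o _ = (fun y : G => y^-1) \o (\val : T -> G)); last exact/funext.
apply: continuous_comp.
  exact: subgroup_val_continuous.
exact: invg_continuous.
Qed.

HB.instance Definition _ :=
  isTopologicalGroup.Build T subgroup_mul_continuous subgroup_inv_continuous.

End SubgroupTopGroup.

Definition quotT (G : topGroupType) (N : normalSubgroup G) : Type :=
  quotient_topology {eq_quot same_coset_equiv N}%qT.

Section QuotientTopGroup.
Variables (G : topGroupType) (N : normalSubgroup G).
Local Notation Q := (quotT N).

HB.instance Definition _ := Topological.on Q.
HB.instance Definition _ := Quotient.on Q.

Definition quot_proj (x : G) : Q := \pi_Q%qT x.
Local Notation q := quot_proj.

Lemma quot_projP x y : q x = q y <-> nsg_set N (x^-1 * y).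
Proof.
split=> [/eqquotP/same_cosetP//|xy].
exact/eqquotP/same_cosetP.
Qed.

Lemma quot_reprK c : q (repr c) = c.
Proof. exact: reprK. Qed.

Definition quot_one : Q := q 1.
Definition quot_inv (c : Q) : Q := q (repr c)^-1.
Definition quot_mul (c d : Q) : Q := q (repr c * repr d).

Lemma quot_mulE x y : quot_mul (q x) (q y) = q (x * y).
Proof.
apply/quot_projP; have /quot_projP Nx := quot_reprK (q x).
have /quot_projP Ny := quot_reprK (q y).
set a := repr (q x) in Nx *; set b := repr (q y) in Ny *.
have -> : (a * b)^-1 * (x * y) = (a^-1 * x) ^ b * (b^-1 * y).
  by rewrite invgM /conjg -!mulgA; congr (_ * (_ * (_ * _))); rewrite mulVKg.
by apply: nsgM => //; exact: nsg_normal.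
Qed.

Lemma quot_invE x : quot_inv (q x) = q x^-1.
Proof.
apply/quot_projP; have /quot_projP Nx := quot_reprK (q x).
have := nsg_normal x^-1 (nsgV Nx).
by rewrite /conjg !invgK invgM invgK -mulgA mulVKg.
Qed.

Lemma quot_mulA : associative quot_mul.
Proof.
move=> c d e; rewrite -(quot_reprK c) -(quot_reprK d) -(quot_reprK e).
by rewrite !quot_mulE mulgA.
Qed.

Lemma quot_mul1g : left_id quot_one quot_mul.
Proof. by move=> c; rewrite -(quot_reprK c) quot_mulE mul1g. Qed.

Lemma quot_mulg1 : right_id quot_one quot_mul.
Proof. by move=> c; rewrite -(quot_reprK c) quot_mulE mulg1. Qed.

Lemma quot_mulVg : left_inverse quot_one quot_inv quot_mul.
Proof. by move=> c; rewrite -(quot_reprK c) quot_invE quot_mulE mulVg. Qed.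

Lemma quot_mulgV : right_inverse quot_one quot_inv quot_mul.
Proof. by move=> c; rewrite -(quot_reprK c) quot_invE quot_mulE mulgV. Qed.

HB.instance Definition _ := isGroup.Build Q
  quot_mulA quot_mul1g quot_mulg1 quot_mulVg quot_mulgV.

Lemma quot_projM : {morph q : x y / x * y}.
Proof. by move=> x y; rewrite -quot_mulE. Qed.

Lemma quot_proj_continuous : continuous q.
Proof. exact: pi_continuous. Qed.

Lemma quot_continuous (X : topologicalType) (f : Q -> X) :
  continuous (f \o q) -> continuous f.
Proof. by move=> cf; apply/quotient_continuous. Qed.

Lemma mulgr_continuous (n : G) : continuous (fun x : G => x * n).
Proof.
move=> x; apply: (@cvg_comp _ _ _ (fun y : G => (y, n))
  (fun z : G * G => z.1 * z.2) _ (nbhs (x, n))); last first.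
  exact: (@mulg_continuous G (x, n)).
by apply: cvg_pair; [exact: cvg_id|exact: cvg_cst].
Qed.

Lemma quot_proj_open (A : set G) : open A -> open (q @` A).
Proof.
move=> oA; rewrite /open/= /quotient_open.
rewrite (_ : _ @^-1` _ = \bigcup_(n in nsg_set N) ((fun x => x * n) @^-1` A)).
  apply: bigcup_open => n _; apply: open_comp => // x _.
  exact: mulgr_continuous.
apply/seteqP; split => x /=.
  move=> [a Aa /esym/quot_projP Nxa]; exists (x^-1 * a) => //=.
  by rewrite mulVKg.
move=> [n Nn /= Axn]; exists (x * n) => //.
apply/quot_projP; rewrite invgM -mulgA mulVg mulg1; exact: nsgV.
Qed.

Lemma quot_mul_continuous : continuous (fun x : Q * Q => x.1 * x.2).
Proof.
move=> [c d]; rewrite -(quot_reprK c) -(quot_reprK d) /=.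
set x := repr c; set y := repr d => W /=; rewrite /continuous_at/= -quot_projM.
move=> /quot_proj_continuous /(@mulg_continuous G (x, y)) /=.
move=> [[A B] /= [nA nB] AB].
have := nA; rewrite nbhsE => -[A' [oA A'x] A'A].
have := nB; rewrite nbhsE => -[B' [oB B'y] B'B].
exists (q @` A', q @` B') => /=.
  by split; apply: open_nbhs_nbhs; split;
    [exact: quot_proj_open|exists x|exact: quot_proj_open|exists y].
move=> [_ _] /= [[a A'a <-] [b B'b <-]]; rewrite -quot_projM.
by apply: (AB (a, b)); split; [exact: A'A|exact: B'B].
Qed.

Lemma quot_inv_continuous : continuous (fun x : Q => x^-1).
Proof.
apply: quot_continuous => x.
rewrite (_ : _ \o _ = q \o (fun y : G => y^-1)); last first.
  by apply/funext => y /=; rewrite -quot_invE.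
apply: continuous_comp; first exact: invg_continuous.
exact: quot_proj_continuous.
Qed.

HB.instance Definition _ :=
  isTopologicalGroup.Build Q quot_mul_continuous quot_inv_continuous.

End QuotientTopGroup.
Arguments quot_proj {G} N x.

Definition top_automorphism (G : topGroupType) (phi : G -> G) : Prop :=
  [/\ {morph phi : x y / x * y}, continuous phi &
      exists psi : G -> G, [/\ cancel phi psi, cancel psi phi & continuous psi]].

Section InducedMaps.
Variables (G : topGroupType) (N : normalSubgroup G) (phi : G -> G).

Lemma restr_subproof (phiN : phi @` N = N) (x : subgroupT N) :
  phi (\val x) \in (N : set G).
Proof.
have : (phi @` N) (phi (\val x)) by exists (\val x) => //; exact: set_valP.
by rewrite phiN => /mem_set.
Qed.

Definition restr (phiN : phi @` N = N) (x : subgroupT N) : subgroupT N :=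
  Sub (phi (\val x)) (restr_subproof phiN x).

(* Independent of the representative when phi is a group morphism and phi(N)  *)
(* = N: see quot_mapE.                                                        *)
Definition quot_map (c : quotT N) : quotT N := quot_proj N (phi (repr c)).

Lemma quot_mapE : {morph phi : x y / x * y} -> phi @` N = N ->
  forall x, quot_map (quot_proj N x) = quot_proj N (phi x).
Proof.
move=> phiM phiN x; apply/quot_projP.
have phi1 : phi 1 = 1 by apply: (@mulgI _ (phi 1)); rewrite -phiM !mulg1.
have phiV y : phi y^-1 = (phi y)^-1.
  by apply: (@mulgI _ (phi y)); rewrite -phiM !mulgV.
rewrite -phiV -phiM -phiN; exists ((repr (quot_proj N x))^-1 * x) => //.
by apply/quot_projP; exact: quot_reprK.
Qed.

End InducedMaps.

Lemma restr_top_automorphism (G : topGroupType) (N : normalSubgroup G)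
    (phi : G -> G) (phiN : phi @` N = N) :
  top_automorphism phi -> top_automorphism (restr phiN).
Proof.
move=> [phiM cphi [psi [phiK psiK cpsi]]].
have psiN : psi @` N = N.
  by rewrite -[in LHS]phiN image_comp (_ : _ \o _ = id) ?image_id//; apply/funext.
have cr f (fN : f @` N = N) : continuous f -> continuous (restr fN).
  move=> cf; apply: subgroup_continuous => x.
  rewrite (_ : _ \o _ = f \o (\val : subgroupT N -> G)); last exact/funext.
  by apply: continuous_comp; [exact: subgroup_val_continuous|exact: cf].
split; [|exact: cr|exists (restr psiN); split; last exact: cr].
- by move=> x y; apply/val_inj; rewrite /= phiM.
- by move=> x; apply/val_inj => /=.
- by move=> x; apply/val_inj => /=.
Qed.

Lemma quot_map_top_automorphism (G : topGroupType) (N : normalSubgroup G)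
    (phi : G -> G) : phi @` N = N ->
  top_automorphism phi -> top_automorphism (@quot_map G N phi).
Proof.
move=> phiN [phiM cphi [psi [phiK psiK cpsi]]].
have psiN : psi @` N = N.
  by rewrite -[in LHS]phiN image_comp (_ : _ \o _ = id) ?image_id//; apply/funext.
have psiM : {morph psi : x y / x * y}.
  by move=> x y; rewrite -[in LHS](psiK x) -[in LHS](psiK y) -phiM phiK.
have cq f : {morph f : x y / x * y} -> f @` N = N -> continuous f ->
    continuous (@quot_map G N f).
  move=> fM fN cf; apply: quot_continuous.
  rewrite (_ : _ \o _ = quot_proj N \o f); last first.
    by apply/funext => x /=; rewrite quot_mapE.
  by move=> x; apply: continuous_comp; [exact: cf|exact: quot_proj_continuous].
split; [|exact: cq|exists (quot_map psi); split; last exact: cq].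
- move=> c d; rewrite -(quot_reprK c) -(quot_reprK d) -quot_projM.
  by rewrite !quot_mapE// phiM quot_projM.
- by move=> c; rewrite -(quot_reprK c) !quot_mapE// phiK.
- by move=> c; rewrite -(quot_reprK c) !quot_mapE// psiK.
Qed.

(* The family B(G). *)
Definition open_compact_subgroup (G : topGroupType) (U : set G) : Prop :=
  [/\ subgroup U, open U & compact U].

(* [U : V] for a subgroup V of U, by counting left cosets; fset_set makes it  *)
(* 0 if there are infinitely many, which cannot happen for U compact and V    *)
(* open.                                                                      *)
Definition subgroup_index (G : groupType) (U V : set G) : nat :=
  #|` fset_set [set (fun y => x * y) @` V | x in U] |.

Section Entropy.
Variables (R : realType) (G : topGroupType) (psi : G -> G).

(* C_n(psi, U); for n = 0 this is the whole of G, but only n >= 1 matters for *)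
(* the limit in H_top.                                                        *)
Definition cotraj_n (U : set G) (n : nat) : set G :=
  \bigcap_(i < n) iter i psi @^-1` U.

(* C(psi, U) *)
Definition cotraj (U : set G) : set G := \bigcap_n iter n psi @^-1` U.

Definition H_top (U : set G) : R :=
  limn (fun n : nat => (ln (subgroup_index U (cotraj_n U n))%:R / n%:R)%R).

Definition h_top : \bar R :=
  ereal_sup [set (H_top U)%:E | U in @open_compact_subgroup G].

End Entropy.

(* Main.v *)
Require Import Defs.
From mathcomp Require Import all_boot all_order all_algebra finmap ring.
From mathcomp Require Import all_classical all_reals all_analysis.

(** The two identities on cotrajectories hold because the inclusion of N and
    the projection q commute with the iterates of the three maps, together
    with q^-1(q(U)) = U when N is contained in U.

    For the entropies, let psi be the restriction of phi to N or the map it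
    induces on G/N. It is enough to find, for each open compact subgroup V of
    the domain of psi, an open compact subgroup U of G whose entropy is at
    least that of V. Van Dantzig's theorem ([van_dantzig]) provides U inside
    any open set around 1: for the restriction, an open set whose trace on N
    is V; for the quotient, q^-1(V). Put V' = N /\ U, respectively V' = q(U);
    this is an open subgroup of V, and a lift f : V' -> U (the inclusion, or a
    section of q) shows that
      [V : C_n(V)] <= [V : C_n(V')] = [V : V'] [V' : C_n(V')]
                   <= [V : V'] [U : C_n(U)].
    The factor [V : V'] is finite and does not depend on n, so that it
    disappears after taking logarithms and dividing by n ([H_top_le]).

    Comparing limits requires that they exist ([H_top_cvg]): as
    C_(n+1) = U /\ psi^-1(C_n), the map psi embeds the cosets of C_(n+2) in
    C_(n+1) into those of C_(n+1) in C_n for n >= 1, hence the indices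
    [C_n : C_(n+1)] are nonincreasing natural numbers, eventually equal to
    some a. Then [U : C_n] is eventually geometric of ratio a, and the limit
    is ln a.

    Van Dantzig's theorem is obtained in two steps. In a compact neighbourhood
    of 1, the component {1} is an intersection of relatively clopen sets, which
    provides arbitrarily small compact open neighbourhoods A of 1
    ([connected_component_clopen_nbhs]). Then the elements that stabilise A by
    right translation form an open subgroup contained in A
    ([compact_open_subgroup_nbhs]). *)

Set Implicit Arguments.
Unset Strict Implicit.
Unset Printing Implicit Defensive.

Import Order.TTheory GRing.Theory Num.Theory numFieldNormedType.Exports.

Local Open Scope classical_set_scope.
Local Open Scope group_scope.

(** * Counting finite images *)

(** Every index comparison below goes through this lemma. Counting the values
    of [p] rather than the elements of [D] lets [p] be a projection onto
    cosets and [g] a map that is only compatible with cosets, such as a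
    choice of representatives. *)
Lemma fset_set_image_inj (X : Type) (T1 T2 : choiceType) (p : X -> T1)
    (g : X -> T2) (D : set X) (B : set T2) :
  finite_set B -> (forall x, D x -> B (g x)) ->
  (forall x y, D x -> D y -> g x = g y -> p x = p y) ->
  finite_set (p @` D) /\ (#|` fset_set (p @` D)| <= #|` fset_set B|)%N.
Proof.
move=> finB gB gp.
have [->|/set0P[x0 Dx0]] := eqVneq D set0.
  by rewrite image_set0 fset_set0 cardfs0; split.
(* h is a partial inverse of g; since g separates the values of p, the     *)
(* composite p \o h maps the image of g onto that of p.                    *)
have /choice[h hP] (b : T2) :
    exists x, D x /\ ((g @` D) b -> g x = b).
  have [[x Dx <-]|nb] := pselect ((g @` D) b); first by exists x.
  by exists x0.
have pE : p @` D = (p \o h) @` (g @` D).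
  apply/seteqP; split=> [_ [x Dx <-]|_ [_ [x Dx <-] <-]] /=.
    exists (g x); first by exists x.
    by apply: gp => //; [exact: (hP _).1|apply: (hP _).2; exists x].
  by exists (h (g x)) => //; exact: (hP _).1.
have gDB : g @` D `<=` B by move=> _ [x Dx <-]; exact: gB.
have fingD : finite_set (g @` D) by exact: sub_finite_set finB.
split; first by rewrite pE; exact: finite_image.
rewrite pE fset_set_image// (leq_trans (leq_imfset_card _ _ _))//.
by apply: fsubset_leq_card; rewrite -fset_set_sub.
Qed.

Lemma cardfsM (K K' : choiceType) (A : {fset K}) (B : {fset K'}) :
  (#|` (A `*` B)%fset| = #|` A| * #|` B|)%N.
Proof.
rewrite -(size_allpairs pair); apply/perm_size/uniq_perm.
    exact: fset_uniq.
  apply: allpairs_uniq; [exact: fset_uniq|exact: fset_uniq|].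
  by move=> [? ?] [? ?].
move=> [a b]; rewrite in_fsetM/=; apply/andP/allpairsP => [[Aa Bb]|].
  by exists (a, b).
by move=> [[x y] /= [Ax By [-> ->]]].
Qed.

(** * Subgroups and indices *)

Section Index.
Variable G : groupType.
Implicit Types (A B C U V : set G) (x y : G).

Lemma subgroupP A :
  A 1 -> (forall x y, A x -> A y -> A (x^-1 * y)) -> subgroup A.
Proof.
move=> A1 AVM; have AV x : A x -> A x^-1.
  by move=> Ax; rewrite -[_^-1]mulg1; exact: AVM.
split=> [|x y]; rewrite !inE// => Ax Ay.
by rewrite -[x]invgK; apply: AVM; exact: AV.
Qed.

Lemma subgroup1 A : subgroup A -> A 1.
Proof. by case=> /set_mem. Qed.

Lemma subgroupV A x : subgroup A -> A x -> A x^-1.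
Proof. by move=> /group_closedV AV /mem_set/AV/set_mem. Qed.

Lemma subgroupM A x y : subgroup A -> A x -> A y -> A (x * y).
Proof.
by move=> /group_closedM AM /mem_set Ax /mem_set/(AM _ _ Ax)/set_mem.
Qed.

Lemma subgroupVM A x y : subgroup A -> A x -> A y -> A (x^-1 * y).
Proof. by move=> sA Ax; apply: subgroupM => //; exact: subgroupV. Qed.

Lemma subgroupI A B : subgroup A -> subgroup B -> subgroup (A `&` B).
Proof.
move=> sA sB; apply: subgroupP => [|x y [Ax Bx] [Ay By]].
  by split; exact: subgroup1.
by split; exact: subgroupVM.
Qed.

Definition lcoset V x : set G := (fun y => x * y) @` V.

Lemma lcoset_eqP V x y : subgroup V ->
  lcoset V x = lcoset V y <-> V (x^-1 * y).
Proof.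
move=> sV; split=> [xy|Vxy].
  have : lcoset V y y by exists 1; [exact: subgroup1|rewrite mulg1].
  by rewrite -xy => -[z Vz <-]; rewrite mulKg.
apply/seteqP; split=> _ [z Vz <-].
  exists (y^-1 * x * z); last by rewrite -mulgA mulVKg.
  apply: subgroupM => //; rewrite -[y^-1 * x]invgK invgM invgK.
  exact: subgroupV.
by exists (x^-1 * y * z); [exact: subgroupM|rewrite -mulgA mulVKg].
Qed.

Definition fin_index U V := finite_set (lcoset V @` U).

Lemma subgroup_index_gt0 U V : subgroup U -> fin_index U V ->
  (0 < subgroup_index U V)%N.
Proof.
move=> sU finUV; rewrite lt0n cardfs_eq0; apply/eqP => /(fset_set_set0 finUV).
by apply/eqP/set0P; exists (lcoset V 1), 1 => //; exact: subgroup1.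
Qed.

End Index.

(** [f] sends representatives of distinct cosets of [V] to distinct cosets of
    [V']. It will be the identity for inclusions of subgroups, an endomorphism
    for preimages, and a set-theoretic section for quotients. *)
Lemma subgroup_index_inj (G1 G2 : groupType) (f : G1 -> G2)
    (U V : set G1) (U' V' : set G2) :
  subgroup V -> subgroup V' -> fin_index U' V' ->
  (forall x, U x -> U' (f x)) ->
  (forall x y, U x -> U y -> V' ((f x)^-1 * f y) -> V (x^-1 * y)) ->
  fin_index U V /\ (subgroup_index U V <= subgroup_index U' V')%N.
Proof.
move=> sV sV' fin' fU fV.
apply: (@fset_set_image_inj _ _ _ _ (fun x => lcoset V' (f x))) => //.
  by move=> x Ux; exists (f x) => //; exact: fU.
by move=> x y Ux Uy /(lcoset_eqP _ _ sV')/(fV _ _ Ux Uy)/(lcoset_eqP _ _ sV).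
Qed.

(** Once representatives [r] of the left cosets of [B] are fixed, x * C is
    determined by the cosets x * B and (r x)^-1 x * C, and conversely the
    pair of a * B and b * C can be read off the coset (r a) b * C. *)
Lemma subgroup_index_mul (G : groupType) (A B C : set G) :
  subgroup A -> subgroup B -> subgroup C -> C `<=` B -> B `<=` A ->
  fin_index A B -> fin_index B C ->
  fin_index A C /\
  subgroup_index A C = (subgroup_index A B * subgroup_index B C)%N.
Proof.
move=> sA sB sC CB BA finAB finBC.
have coset_eqB x y := lcoset_eqP x y sB.
have coset_eqC x y := lcoset_eqP x y sC.
pose r x := xget 1 (lcoset B x).
have Br x : B ((r x)^-1 * x).
  have : lcoset B x (r x).
    apply: (@xgetI _ _ _ x).
    by exists 1; [exact: subgroup1|rewrite mulg1].
  by move=> [z Bz <-]; rewrite invgM -mulgA mulVg mulg1; exact: subgroupV.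
have Ar x : A x -> A (r x).
  move=> Ax; rewrite (_ : r x = x * ((r x)^-1 * x)^-1); last first.
    by rewrite invgM invgK mulVKg.
  by apply: subgroupM => //; apply: subgroupV => //; exact: BA.
have rE x y : B (x^-1 * y) -> r x = r y by rewrite /r => /coset_eqB ->.
pose P := (lcoset B @` A) `*` (lcoset C @` B).
have finP : finite_set P by exact: finite_setX.
have [finAC leAC] : fin_index A C /\
    (subgroup_index A C <= #|` fset_set P|)%N.
  apply: (@fset_set_image_inj _ _ _ _
    (fun x => (lcoset B x, lcoset C ((r x)^-1 * x)))) => //.
    move=> x Ax; split; first by exists x.
    by exists ((r x)^-1 * x); first exact: Br.
  move=> x y Ax Ay [/coset_eqB/rE <- /coset_eqC].
  by rewrite invgM invgK -mulgA mulVKg => /coset_eqC.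
split => //; apply/eqP; rewrite eqn_leq.
have cardP : #|` fset_set P| = (subgroup_index A B * subgroup_index B C)%N.
  by rewrite fset_setX// cardfsM.
rewrite -cardP leAC /=.
have [||_] := @fset_set_image_inj _ _ _
  (fun ab : G * G => (lcoset B ab.1, lcoset C ab.2))
  (fun ab : G * G => lcoset C (r ab.1 * ab.2)) (A `*` B) (lcoset C @` A) finAC.
- move=> [a b] [/= Aa Bb]; exists (r a * b) => //.
  by apply: subgroupM => //; [exact: Ar|exact: BA].
- move=> [a b] [a' b'] [/= Aa Bb] [/= Aa' Bb'] /coset_eqC Cab.
  have Brr : B ((r a)^-1 * r a').
    have := subgroupM sB Bb (subgroupM sB (CB _ Cab) (subgroupV sB Bb')).
    by rewrite invgM -!mulgA mulgV mulg1 mulVKg.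
  have Baa : B (a^-1 * a').
    have := subgroupM sB (subgroupVM sB (Br a) Brr) (Br a').
    by rewrite invgM invgK -!mulgA !mulVKg.
  have raa := rE _ _ Baa.
  congr (_, _); [exact/coset_eqB|apply/coset_eqC].
  by move: Cab; rewrite raa invgM -mulgA mulKg.
rewrite (_ : _ @` _ = P)//.
apply/seteqP; split=> [_ [[a b] [/= Aa Bb] <-]|].
  by split; [exists a|exists b].
by move=> [_ _] [/= [a Aa <-] [b Bb <-]]; exists (a, b).
Qed.

(** * Existence of the limit defining the entropy *)

Lemma nonincreasing_nat_eventually_cst (a : nat -> nat) :
  (forall n, (a n.+1 <= a n)%N) -> exists m, forall n, (m <= n)%N -> a n = a m.
Proof.
move=> a_anti; have a_le m n : (m <= n)%N -> (a n <= a m)%N.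
  move=> mn; rewrite -(subnKC mn); elim: (n - m)%N => [|k IH].
    by rewrite addn0.
  by rewrite addnS (leq_trans (a_anti _)).
have exv : exists v, `[< exists n, a n = v >].
  by exists (a 0); apply/asboolP; exists 0.
have [v /asboolP[m amv] minv] := ex_minnP exv.
exists m => n mn; apply/eqP; rewrite eqn_leq a_le//= amv.
by apply: minv; apply/asboolP; exists n.
Qed.

Lemma compact_locally_cst_finite (X : topologicalType) (T : choiceType)
    (p : X -> T) (U : set X) : compact U ->
  (forall x, U x -> \forall y \near x, p y = p x) -> finite_set (p @` U).
Proof.
move=> /compact_near_coveringP cU p_cst.
pose F := filter_from [set: {fset T}] (fun s => [set S | (s `<=` S)%fset]).
have FF : Filter F.
  apply: filter_from_filter; first by exists fset0.
  move=> s t _ _; exists (s `|` t)%fset => // S /=; rewrite fsubUset => /andP[].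
  by split.
(* Near-covering along the filter of large finite sets of values replaces   *)
(* the extraction of a finite subcover.                                      *)
have [x Ux|s _ sU] := cU _ F (fun S x => p x \in S) FF.
  exists ([set y | p y = p x], [set S | ([fset p x] `<=` S)%fset]).
    by split; [exact: p_cst|exists [fset p x]%fset].
  by move=> [y S] [/= -> ]; rewrite fsub1set.
apply: (@sub_finite_set _ _ [set` s]); last exact: finite_fset.
by move=> _ [x Ux <-]; apply: (sU s _ x Ux) => /=.
Qed.

Lemma mulgl_continuous (G : topGroupType) (x : G) : continuous (fun y => x * y).
Proof.
move=> y; apply: (@cvg_comp _ _ _ (fun z : G => (x, z))
  (fun z : G * G => z.1 * z.2) _ (nbhs (x, y))).
  by apply: cvg_pair; [exact: cvg_cst|exact: cvg_id].
exact: (@mulg_continuous G (x, y)).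
Qed.

Lemma compact_open_fin_index (G : topGroupType) (U V : set G) :
  compact U -> subgroup V -> open V -> fin_index U V.
Proof.
move=> cU sV oV; apply: compact_locally_cst_finite => // x _.
have oxV : open ((fun y => x^-1 * y) @^-1` V).
  by apply: open_comp => // y _; exact: mulgl_continuous.
have xVx : ((fun y => x^-1 * y) @^-1` V) x.
  by rewrite /preimage/= mulVg; exact: subgroup1.
apply: filterS (open_nbhs_nbhs (conj oxV xVx)) => y /= Vxy.
exact/esym/lcoset_eqP.
Qed.

Section Cotrajectory.
Variables (G : topGroupType) (psi : G -> G) (U : set G).
Hypotheses (psiM : {morph psi : x y / x * y}) (psi_cont : continuous psi).
Hypotheses (sU : subgroup U) (oU : open U) (cU : compact U).
Local Notation C := (cotraj_n psi U).

Lemma morph1 : psi 1 = 1.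
Proof. by apply: (@mulgI _ (psi 1)); rewrite -psiM !mulg1. Qed.

Lemma morphV x : psi x^-1 = (psi x)^-1.
Proof. by apply: (@mulgI _ (psi x)); rewrite -psiM !mulgV morph1. Qed.

Lemma cotraj_nS n : C n.+1 = U `&` psi @^-1` C n.
Proof.
apply/seteqP; split=> [x Cx|x [Ux Cx] [|i] ltin] //.
  split=> [|i ltin]; first exact: (Cx 0).
  by have := Cx i.+1 ltin; rewrite /= -iterS iterSr.
by rewrite /preimage/= -iterS iterSr; apply: Cx.
Qed.

Lemma cotraj_n_anti m n : (m <= n)%N -> C n `<=` C m.
Proof. by move=> mn x Cx i im; apply: Cx; exact: leq_trans mn. Qed.

Lemma cotraj_n_sub n : C n.+1 `<=` U.
Proof. by rewrite cotraj_nS => x []. Qed.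

Lemma cotraj_n_subgroup n : subgroup (C n).
Proof.
elim: n => [|n IH].
  exact: subgroupP.
rewrite cotraj_nS; apply: subgroupI => //; apply: subgroupP => [|x y Cx Cy].
  by rewrite /preimage/= morph1; exact: subgroup1.
by rewrite /preimage/= psiM morphV; exact: (@subgroupVM _ (C n)).
Qed.

Lemma cotraj_n_open n : open (C n).
Proof.
elim: n => [|n IH].
  rewrite (_ : C 0 = setT); first exact: openT.
  by apply/seteqP; split.
rewrite cotraj_nS; apply: openI => //.
by apply: open_comp => // x _; exact: psi_cont.
Qed.

Lemma cotraj_n_fin_index n : fin_index U (C n).
Proof.
apply: (@compact_open_fin_index G); first exact: cU.
  exact: cotraj_n_subgroup.
exact: cotraj_n_open.
Qed.

(** The indices start at [n.+1] because [cotraj_n psi U 0] is the whole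
    group, which is in general not contained in [U]. *)
Lemma cotraj_n_succ_index n :
  fin_index (C n.+1) (C n.+2) /\
  subgroup_index U (C n.+2) =
    (subgroup_index U (C n.+1) * subgroup_index (C n.+1) (C n.+2))%N.
Proof.
have finS : fin_index (C n.+1) (C n.+2).
  have [||//] := @subgroup_index_inj _ _ id (C n.+1) (C n.+2) U (C n.+2)
    (cotraj_n_subgroup _) (cotraj_n_subgroup _) (cotraj_n_fin_index _).
  - exact: cotraj_n_sub.
  - by [].
split => //.
have [|||||||_ //] := @subgroup_index_mul _ U (C n.+1) (C n.+2).
- exact: sU.
- exact: cotraj_n_subgroup.
- exact: cotraj_n_subgroup.
- exact: cotraj_n_anti.
- exact: cotraj_n_sub.
- exact: cotraj_n_fin_index.
- exact: finS.
Qed.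

(** [psi] maps C_(n+2) into C_(n+1), and an element of U is in C_(n+3) as soon
    as its image by [psi] is in C_(n+2). *)
Lemma cotraj_n_succ_index_anti n :
  (subgroup_index (C n.+2) (C n.+3) <= subgroup_index (C n.+1) (C n.+2))%N.
Proof.
have [||_ //] := @subgroup_index_inj _ _ psi (C n.+2) (C n.+3) _ _
    (cotraj_n_subgroup _) (cotraj_n_subgroup _) (cotraj_n_succ_index n).1.
  by move=> x; rewrite cotraj_nS => -[].
move=> x y Cx Cy; rewrite -morphV -psiM => Cxy.
rewrite [C n.+3]cotraj_nS; split => //.
exact: subgroupVM sU (cotraj_n_sub Cx) (cotraj_n_sub Cy).
Qed.

Variable R : realType.

(** From some rank m on, the successive indices [C_(n+1) : C_(n+2)] are
    constant, equal to [a]; the limit is then ln a. *)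
Lemma H_top_cvg :
  cvgn (fun n : nat => (ln (subgroup_index U (C n))%:R / n%:R)%R : R).
Proof.
have [m am] := nonincreasing_nat_eventually_cst cotraj_n_succ_index_anti.
set a := subgroup_index (C m.+1) (C m.+2) in am.
pose c n := subgroup_index U (C n).
have c_gt0 n : (0 < c n)%N.
  by apply: subgroup_index_gt0 => //; exact: cotraj_n_fin_index.
have cE k : c (k + m.+1)%N = (c m.+1 * a ^ k)%N.
  elim: k => [|k IH]; first by rewrite muln1.
  rewrite addSn addnS /c (cotraj_n_succ_index (k + m)).2 am ?leq_addl//.
  by rewrite expnSr mulnA -IH addnS.
have a_gt0 : (0 < a)%N.
  by have := c_gt0 (1 + m.+1)%N; rewrite cE muln_gt0 expn1 => /andP[].
apply: (@cvgP _ _ (ln a%:R)).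
rewrite -(cvg_shiftn m.+1) /=.
pose d : R := (ln (c m.+1)%:R - m.+1%:R * ln a%:R)%R.
apply: (@cvg_trans _ ((fun k : nat => d * (k + m.+1)%:R^-1 + ln a%:R)%R @ \oo)).
  apply: near_eq_cvg; near=> k.
  rewrite -/(c _) cE natrM natrX lnM ?posrE ?ltr0n ?expn_gt0//; last first.
    by rewrite exprn_gt0// ltr0n.
  rewrite lnXn ?ltr0n// /d.
  have kN : ((k + m.+1)%:R != 0 :> R)%R by rewrite pnatr_eq0 addnS.
  by apply: (mulIf kN); field.
have : (fun k : nat => d * (k + m.+1)%:R^-1 + ln a%:R)%R @ \oo -->
    (d * 0 + ln a%:R)%R.
  apply: cvgD; last exact: cvg_cst.
  apply: cvgM; first exact: cvg_cst.
  under eq_fun do rewrite addnS.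
  by have := @cvg_harmonic R; rewrite -(cvg_shiftn m).
by rewrite mulr0 add0r.
Unshelve. all: by end_near. Qed.

End Cotrajectory.

(** * Comparison of entropies across two groups *)

Definition continuous_endomorphism (G : topGroupType) (psi : G -> G) :=
  {morph psi : x y / x * y} /\ continuous psi.

(** The index of C_n(psi1, V) in [V] is at most that of C_n(psi1, V'), which is
    [V : V'] times an index that [f] bounds by [U : C_n(psi2, U)]. The bounded
    factor [V : V'] contributes ln [V : V'] / n, which tends to 0. *)
Lemma H_top_le (R : realType) (G1 G2 : topGroupType) (psi1 : G1 -> G1)
    (psi2 : G2 -> G2) (V V' : set G1) (U : set G2) (f : G1 -> G2) :
  continuous_endomorphism psi1 -> continuous_endomorphism psi2 ->
  open_compact_subgroup V -> open_compact_subgroup U ->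
  subgroup V' -> open V' -> V' `<=` V -> (forall x, V' x -> U (f x)) ->
  (forall n x y, V' x -> V' y ->
    cotraj_n psi2 U n ((f x)^-1 * f y) -> cotraj_n psi1 V' n (x^-1 * y)) ->
  (H_top R psi1 V <= H_top R psi2 U)%R.
Proof.
move=> [psi1M psi1c] [psi2M psi2c] Voc Uoc sV' oV' V'V fU fC.
have [sV oV cV] := Voc; have [sU oU cU] := Uoc.
have finVV' : fin_index V V' by exact: compact_open_fin_index.
set k := subgroup_index V V'.
have k_gt0 : (0 < k)%N by exact: subgroup_index_gt0.
pose c1 n := subgroup_index V (cotraj_n psi1 V n).
pose c2 n := subgroup_index U (cotraj_n psi2 U n).
have c1_gt0 n : (0 < c1 n)%N.
  by apply: subgroup_index_gt0 => //; exact: cotraj_n_fin_index.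
have c2_gt0 n : (0 < c2 n)%N.
  by apply: subgroup_index_gt0 => //; exact: cotraj_n_fin_index.
have sC' n : subgroup (cotraj_n psi1 V' n) by exact: cotraj_n_subgroup.
have c12 n : (c1 n.+1 <= k * c2 n.+1)%N.
  have [||finC' leC'] := @subgroup_index_inj _ _ f V' (cotraj_n psi1 V' n.+1)
      U (cotraj_n psi2 U n.+1) (sC' _) (cotraj_n_subgroup psi2M sU _)
      (cotraj_n_fin_index psi2M psi2c sU oU cU _).
  - exact: fU.
  - by move=> x y V'x V'y; exact: fC.
  have [|||||||finVC' indVC'] :=
    @subgroup_index_mul _ V V' (cotraj_n psi1 V' n.+1) => //.
  - exact: cotraj_n_sub.
  have [||_ le1] := @subgroup_index_inj _ _ id V (cotraj_n psi1 V n.+1)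
      V (cotraj_n psi1 V' n.+1) (cotraj_n_subgroup psi1M sV _) (sC' _)
      finVC' => //.
    by move=> x y _ _ Cxy i /Cxy; exact: V'V.
  by rewrite (leq_trans le1)// indVC' leq_mul2l leC' orbT.
have lnk0 : (fun n => ln k%:R * (n.+1)%:R^-1 : R)%R @ \oo --> (0 : R)%R.
  rewrite -[X in _ --> X](mulr0 (ln k%:R)).
  by apply: cvgM; [exact: cvg_cst|exact: cvg_harmonic].
pose e (c : nat -> nat) (n : nat) : R := (ln (c n)%:R / n%:R)%R.
have cv1 : e c1 @ \oo --> H_top R psi1 V by exact: H_top_cvg.
have cv2 : e c2 @ \oo --> H_top R psi2 U by exact: H_top_cvg.
rewrite -(cvg_shiftn 1) in cv1; rewrite -(cvg_shiftn 1) in cv2.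
rewrite -[leRHS]add0r.
apply: ler_cvg_to cv1 (cvgD lnk0 cv2) _.
apply: nearW => n /=; rewrite /e addn1.
rewrite -[leRHS]/(ln k%:R / n.+1%:R + ln (c2 (n + 1)%N)%:R / (n + 1)%:R)%R.
rewrite addn1 -mulrDl ler_pM2r ?invr_gt0//.
rewrite -lnM ?posrE ?ltr0n// -natrM.
rewrite ler_ln ?posrE ?ltr0n ?muln_gt0 ?k_gt0 ?c1_gt0 ?c2_gt0//.
by rewrite ler_nat; exact: c12.
Qed.

(** * Compact open subgroups of totally disconnected groups *)

Lemma compact_closed_separation (T : topologicalType) (A B : set T) :
  @regular_space T -> compact A -> closed B -> A `&` B = set0 ->
  exists C, [/\ closed C, A `<=` C° & C `&` B = set0].
Proof.
move=> regT /compact_near_coveringP cA clB AB0.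
pose avoid := [set C | closed C /\ C `&` B = set0].
pose F := filter_from avoid (fun C => [set C' | C `<=` C']).
have FF : Filter F.
  apply: filter_from_filter; first exists set0 => //.
    by split; [exact: closed0|exact: set0I].
  move=> C D [clC CB] [clD DB]; exists (C `|` D).
    by split; [exact: closedU|rewrite setIUl CB DB setU0].
  by move=> E /=; rewrite subUset => -[].
have [x Ax|C [clC CB] AC] := cA _ F (fun C x => C° x) FF.
  have nBx : nbhs x (~` B).
    apply: open_nbhs_nbhs; split; first exact: closed_openC.
    by move=> Bx; have : (A `&` B) x by []; rewrite AB0.
  have [M nM MB] := regT _ _ nBx.
  exists (M°, [set C | closure M `<=` C]) => /=.
    split; first exact: nbhs_interior.
    exists (closure M) => //; split; first exact: closed_closure.
    exact/disjoints_subset.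
  move=> [y C] /= [My MC].
  by apply: filterS My => z; move/subset_closure/MC.
by exists C; split => //; apply: AC.
Qed.

(** In a compact Hausdorff space, the intersection [Q] of all clopen sets that
    contain x is connected, hence contained in the component of x: a splitting
    of [Q] into two closed pieces extends, by separation and compactness, to a
    splitting of a clopen set that contains [Q]. By compactness again, a
    clopen set around x is already contained in [O]. Clopen subsets [D] of the
    compact set [K] are described by [D] and its complement in [K] being
    closed, which avoids working in the subspace topology. *)
Lemma connected_component_clopen_nbhs (T : topologicalType) (K O : set T) x :
  hausdorff_space T -> @regular_space T -> compact K -> K x -> open O ->
  connected_component K x `<=` O ->
  exists D, [/\ D x, D `<=` K `&` O, closed D & closed (K `\` D)].
Proof.
move=> hT regT cK Kx.
have clK : closed K by exact: compact_closed.
have closedDopen (C P : set T) : closed C -> open P -> closed (C `\` P).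
  by move=> clC oP; apply: closedI => //; exact: open_closedC.
pose Fam := [set D | [/\ D x, D `<=` K, closed D & closed (K `\` D)]].
have FamK : Fam K.
  by split => //; rewrite setDv; exact: closed0.
have FamI D E : Fam D -> Fam E -> Fam (D `&` E).
  move=> [Dx DK cD cD'] [Ex EK cE cE']; split => //.
  - by move=> y [/DK].
  - exact: closedI.
  - by rewrite setDIr; exact: closedU.
pose Q := \bigcap_(D in Fam) D.
(* Compactness: an open set that contains Q contains a member of Fam. *)
have QFam P : open P -> Q `<=` P -> exists2 D, Fam D & D `<=` P.
  move=> oP QP; pose F := filter_from Fam (fun D => [set E | E `<=` D]).
  have FF : Filter F.
    apply: filter_from_filter; first by exists K.
    move=> D E FD FE; exists (D `&` E); first exact: FamI.
    by move=> X /=; rewrite subsetI.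
  have cKP : compact (K `\` P).
    apply: subclosed_compact cK _; last by move=> y [].
    by apply: closedDopen.
  have /compact_near_coveringP cov := cKP.
  have [y [Ky nPy]|D FD KPD] := cov _ F (fun D y => ~ D y) FF.
    have [D FD nDy] : exists2 D, Fam D & ~ D y.
      apply: contrapT => nD; apply/nPy/QP => D FD; apply: contrapT => nDy.
      by apply: nD; exists D.
    exists (~` D, [set E | E `<=` D]) => /=.
      split; last by exists D.
      apply: open_nbhs_nbhs; split => //; apply: closed_openC.
      by case: FD.
    by move=> [z E] /= [nDz ED] /ED.
  exists D => // y Dy; apply: contrapT => nPy.
  apply: (KPD D _ y) => //; split => //.
  by case: FD => _ + _ _; exact.
have Qx : Q x by move=> D [].
have QK : Q `<=` K by move=> y /(_ K FamK).
have clQ : closed Q by apply: closed_bigI => D [].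
have cQ : compact Q by exact: subclosed_compact cK QK.
(* A closed splitting of Q puts all of Q on the side of x. *)
have Qsplit E1 E2 : closed E1 -> closed E2 -> E1 `&` E2 = set0 ->
    Q `<=` E1 `|` E2 -> E1 x -> Q `&` E2 = set0.
  move=> cl1 cl2 E12 QE E1x.
  have cQE1 : compact (Q `&` E1).
    by apply: subclosed_compact cQ _; [exact: closedI|move=> y []].
  have [|C [clC E1C CE2]] := compact_closed_separation regT cQE1 cl2.
    by rewrite -setIA E12 setI0.
  have [||D FD DO] := QFam (C° `|` ~` C).
  - by apply: openU; [exact: open_interior|exact: closed_openC].
  - move=> y Qy; have [E1y|E2y] := QE _ Qy; first by left; apply: E1C.
    by right => Cy; have : (C `&` E2) y by []; rewrite CE2.
  have FDC : Fam (D `&` C).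
    have [Dx DK clD clD'] := FD.
    split; [|by move=> y [/DK]|exact: closedI|].
      by split => //; apply: interior_subset; apply: E1C.
    rewrite setDIr.
    rewrite (_ : _ `|` _ = (K `\` D) `|` (K `\` C°)).
      by apply: closedU => //; apply: closedDopen => //; exact: open_interior.
    apply/seteqP; split=> [y [?|[Ky nCy]]|y [?|[Ky nCy]]].
    - by left.
    - by right; split => // /interior_subset.
    - by left.
    - have [Dy|nDy] := pselect (D y); last by left.
      by right; split => // Cy; case: (DO _ Dy).
  apply/disjoints_subset => y /(_ _ FDC) [_ Cy] E2y.
  by have : (C `&` E2) y by []; rewrite CE2.
have Qconn : connected Q.
  move=> B [b Bb] [C oC BC] [C' clC' BC'].
  have clB : closed B by rewrite BC'; exact: closedI.
  have clQC : closed (Q `\` C) by exact: closedDopen.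
  have QB y : Q y -> ~ C y -> ~ B y by rewrite BC => ? ? [].
  have dsj : B `&` (Q `\` C) = set0.
    by apply/disjoints_subset => y; rewrite BC => -[? ?] [].
  have cov : Q `<=` B `|` (Q `\` C).
    by move=> y Qy; have [Cy|] := pselect (C y); [left; rewrite BC|right].
  have [Bx|nBx] := pselect (B x).
    have Q0 := Qsplit _ _ clB clQC dsj cov Bx.
    apply/seteqP; split=> [y|y Qy]; first by rewrite BC => -[].
    have [//|QCy] := cov _ Qy.
    by have : (Q `&` (Q `\` C)) y by []; rewrite Q0.
  have QB0 : Q `&` B = set0.
    apply: (Qsplit _ _ clQC clB); [by rewrite setIC|by rewrite setUC|].
    by have [] := cov _ Qx.
  have : (Q `&` B) b by split => //; move: Bb; rewrite BC => -[].
  by rewrite QB0.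
move=> oO KO; have [|D FD DO] := QFam O oO.
  by apply: subset_trans KO; exact: connected_component_max.
by exists D; have [Dx DK clD clD'] := FD; split => // y Dy; split; auto.
Qed.

Lemma open_subgroup_clopen (G : topGroupType) (U : set G) :
  subgroup U -> nbhs 1 U -> clopen U.
Proof.
move=> sU nU.
have nU' (x : G) : \forall y \near x, U (x^-1 * y).
  by apply: mulgl_continuous; rewrite mulVg.
split.
  rewrite openE => x Ux; apply: filterS (nU' x) => y Uxy.
  by rewrite -(mulVKg x y); exact: subgroupM.
rewrite -openC openE => x nUx; apply: filterS (nU' x) => y Uxy Uy; apply: nUx.
rewrite -(mulVKg y x) -[y^-1 * x]invgK invgM invgK.
by apply: subgroupM => //; exact: subgroupV.
Qed.

(** Components are closed, so that {1} is closed; the diagonal is its preimage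
    by the continuous map (x, y) |-> x^-1 * y. *)
Lemma tdlc_hausdorff (G : topGroupType) : tdlc G -> hausdorff_space G.
Proof.
move=> [td _] x y xy; apply: contrapT => nxy.
have cl1 : closed [set (1 : G)].
  by rewrite -(td 1 I); exact: component_closed closedT.
have oN1 : open (~` [set (1 : G)]) by exact: closed_openC.
have n1 : nbhs (x^-1 * y) (~` [set (1 : G)]).
  apply: open_nbhs_nbhs; split => // xy1; apply: nxy.
  by rewrite -[RHS](mulVKg x) xy1 mulg1.
have div_cont : (fun z : G * G => z.1^-1 * z.2) @ (x, y) --> x^-1 * y.
  apply: (@cvg_comp _ _ _ (fun z : G * G => (z.1^-1, z.2))
    (fun z : G * G => z.1 * z.2) _ (nbhs (x^-1, y))); last first.
    exact: (@mulg_continuous G (x^-1, y)).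
  apply: cvg_pair; last exact: cvg_snd.
  apply: (@cvg_comp _ _ _ fst _ _ (nbhs x)); first exact: cvg_fst.
  exact: invg_continuous.
have [[A B] /= [nA nB] AB] := div_cont _ n1.
have [z [Az Bz]] := xy _ _ nA nB.
by apply: (AB (z, z)) => //=; rewrite mulVg.
Qed.

(** The subgroup is that of all x such that A * x = A; it lies in [A] because
    1 is in [A], and it is a neighbourhood of 1 because, [A] being compact and
    open, A * x stays in [A] for all x close to 1. *)
Lemma compact_open_subgroup_nbhs (G : topGroupType) (A : set G) :
  compact A -> open A -> A 1 ->
  exists2 U, open_compact_subgroup U & U `<=` A.
Proof.
move=> cA oA A1.
pose U := [set x | forall a, A a -> A (a * x) /\ A (a * x^-1)].
have UA : U `<=` A by move=> x /(_ 1 A1) []; rewrite mul1g.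
have sU : subgroup U.
  apply: subgroupP => [a Aa|x y Ux Uy a Aa]; first by rewrite invg1 mulg1.
  rewrite invgM invgK !mulgA; split.
    by apply: (Uy _ _).1; exact: (Ux _ _).2.
  by apply: (Ux _ _).1; exact: (Uy _ _).2.
have nU : nbhs (1 : G) U.
  have /compact_near_coveringP cov := cA.
  apply: (cov _ (nbhs (1 : G)) (fun x a => A (a * x) /\ A (a * x^-1))) => a Aa.
  have nA : nbhs a A by exact: open_nbhs_nbhs.
  have mulA : (fun z : G * G => z.1 * z.2) @ (a, 1) --> a.
    by have := @mulg_continuous G (a, 1); rewrite /continuous_at/= mulg1.
  have divA : (fun z : G * G => z.1 * z.2^-1) @ (a, 1) --> a.
    apply: (@cvg_comp _ _ _ (fun z : G * G => (z.1, z.2^-1))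
      (fun z : G * G => z.1 * z.2) _ (nbhs (a, 1))); last exact: mulA.
    apply: cvg_pair; first exact: cvg_fst.
    apply: (@cvg_comp _ _ _ snd _ _ (nbhs 1)); first exact: cvg_snd.
    by have := @invg_continuous G 1; rewrite /continuous_at invg1.
  by apply: filterI; [exact: mulA|exact: divA].
have [oU clU] := open_subgroup_clopen sU nU.
exists U => //; split => //; exact: subclosed_compact cA UA.
Qed.

Lemma van_dantzig (G : topGroupType) (W : set G) :
  tdlc G -> open W -> W 1 -> exists2 U, open_compact_subgroup U & U `<=` W.
Proof.
move=> tG oW W1; have hG := tdlc_hausdorff tG; have [td lc] := tG.
have cnbhs (x : G) : exists2 K, nbhs x K & compact K.
  have [K nK [cK _]] := lc x I; exists K => //.
  by move: nK; rewrite /within/=; apply: filterS => y; exact.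
have regG : @regular_space G.
  by move=> x; have [K nK cK] := cnbhs x; exact: compact_regular cK nK.
have [K nK cK] := cnbhs 1.
have [|||D [D1 DKW clD clKD]] :=
  @connected_component_clopen_nbhs G K (K° `&` W) 1 hG regG cK.
- exact: nbhs_singleton.
- by apply: openI => //; exact: open_interior.
- move=> x [B [B1 _ Bconn Bx]].
  have : connected_component setT 1 x by exists B.
  rewrite td// => ->; split => //; exact: nbhs_interior.
(* D is open in G because it lies in the interior of K. *)
have oD : open D.
  rewrite (_ : D = (K° `&` W) `&` ~` (K `\` D)).
    apply: openI; last exact: closed_openC.
    by apply: openI => //; exact: open_interior.
  apply/seteqP; split=> [x Dx|x [[/interior_subset Kx _] nKD]].
    by split; [exact: (DKW _ Dx).2|case].
  by apply: contrapT => nDx; exact: nKD.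
have cD : compact D.
  by apply: subclosed_compact clD cK _ => x /DKW [].
have [U Uoc UD] := compact_open_subgroup_nbhs cD oD D1.
by exists U => // x /UD/DKW [_ []].
Qed.

(** * Restriction to a normal subgroup and passage to the quotient *)

Lemma h_top_le (R : realType) (G1 G2 : topGroupType) (psi1 : G1 -> G1)
    (psi2 : G2 -> G2) :
  (forall V, open_compact_subgroup V -> exists2 U, open_compact_subgroup U &
    (H_top R psi1 V <= H_top R psi2 U)%R) ->
  (h_top R psi1 <= h_top R psi2)%E.
Proof.
move=> H12; apply: ge_ereal_sup => _ [V Voc <-].
have [U Uoc VU] := H12 V Voc.
by apply: ereal_sup_ge; exists (H_top R psi2 U)%:E; [exists U|rewrite lee_fin].
Qed.

Lemma top_automorphism_endo (G : topGroupType) (phi : G -> G) :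
  top_automorphism phi -> continuous_endomorphism phi.
Proof. by case. Qed.

Section Restriction.
Variables (G : topGroupType) (phi : G -> G) (N : normalSubgroup G).
Hypothesis phiN : phi @` nsg_set N = nsg_set N.
Local Notation val := (\val : subgroupT N -> G).

Lemma val_iter_restr n x : val (iter n (restr phiN) x) = iter n phi (val x).
Proof. by elim: n => //= n ->. Qed.

Lemma cotraj_restr U :
  val @` cotraj (restr phiN) (val @^-1` U) = cotraj phi U `&` nsg_set N.
Proof.
apply/seteqP; split=> [_ [x Cx <-]|x [Cx Nx]].
  split; last exact: set_valP.
  by move=> n _; have := Cx n I; rewrite /preimage/= val_iter_restr.
exists (Sub x (mem_set Nx)); last by rewrite SubK.
by move=> n _; rewrite /preimage/= val_iter_restr SubK; exact: Cx.
Qed.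

Lemma h_top_restr_le (R : realType) : tdlc G -> top_automorphism phi ->
  (h_top R (restr phiN) <= h_top R phi)%E.
Proof.
move=> tG phi_aut; apply: h_top_le => V Voc; have [sV oV _] := Voc.
have [W oW WV] := oV.
have W1 : W 1 by have := subgroup1 sV; rewrite -WV.
have [U Uoc UW] := van_dantzig tG oW W1; have [sU oU _] := Uoc.
exists U => //.
apply: (@H_top_le _ _ _ _ _ _ (val @^-1` U) _ val) => //.
- exact/top_automorphism_endo/restr_top_automorphism.
- exact: top_automorphism_endo.
- apply: subgroupP; first exact: (subgroup1 sU).
  by move=> x y Ux Uy; exact: (@subgroupVM _ U).
- by apply: open_comp => // x _; exact: subgroup_val_continuous.
- by rewrite -WV => x /UW.
- by move=> n x y _ _ Cxy i /Cxy; rewrite /preimage/= val_iter_restr.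
Qed.

End Restriction.

Section Quotient.
Variables (G : topGroupType) (phi : G -> G) (N : normalSubgroup G).
Hypotheses (phiM : {morph phi : x y / x * y})
  (phiN : phi @` nsg_set N = nsg_set N).
Local Notation q := (quot_proj N).

Lemma iter_quot_map n x : iter n (quot_map phi) (q x) = q (iter n phi x).
Proof. by elim: n => //= n ->; rewrite quot_mapE. Qed.

Lemma cotraj_quot U : subgroup U -> nsg_set N `<=` U ->
  cotraj (quot_map phi) (q @` U) = q @` cotraj phi U.
Proof.
move=> sU NU; apply/seteqP; split=> [c Cc|_ [x Cx <-] n _]; last first.
  rewrite /preimage/= iter_quot_map; exists (iter n phi x) => //.
  exact: (Cx n I).
rewrite -(quot_reprK c) in Cc *; exists (repr c) => // n _.
have := Cc n I; rewrite /preimage/= iter_quot_map => -[u Uu /quot_projP/NU Uux].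
by rewrite -(mulVKg u (iter _ _ _)); exact: subgroupM.
Qed.

Lemma h_top_quot_le (R : realType) : tdlc G -> top_automorphism phi ->
  (h_top R (@quot_map G N phi) <= h_top R phi)%E.
Proof.
move=> tG phi_aut; apply: h_top_le => V Voc; have [sV oV _] := Voc.
have oW : open (q @^-1` V).
  by apply: open_comp => // x _; exact: quot_proj_continuous.
have [U Uoc UV] := van_dantzig tG oW (subgroup1 sV); have [sU oU _] := Uoc.
exists U => //.
have qVM x y : (q x)^-1 * q y = q (x^-1 * y).
  by rewrite quot_projM -quot_invE.
(* f is a section of q over q(U) with values in U. *)
have /choice[f fP] (c : quotT N) : exists u, (q @` U) c -> U u /\ q u = c.
  have [[u Uu <-]|] := pselect ((q @` U) c); last by exists 1.
  by exists u.
apply: (@H_top_le _ _ _ _ _ _ (q @` U) _ f) => //.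
- exact/top_automorphism_endo/quot_map_top_automorphism.
- exact: top_automorphism_endo.
- apply: subgroupP; first by exists 1 => //; exact: subgroup1.
  move=> _ _ [x Ux <-] [y Uy <-]; rewrite qVM.
  by exists (x^-1 * y) => //; exact: subgroupVM.
- exact: quot_proj_open.
- by move=> _ [u Uu <-]; exact: UV.
- by move=> c /fP [].
move=> n c d /fP [_ fc] /fP [_ fd] Ccd i ltin.
rewrite -fc -fd qVM /preimage/= iter_quot_map.
by exists (iter i phi ((f c)^-1 * f d)) => //; exact: Ccd.
Qed.

End Quotient.

Theorem proposition4p4 (R : realType) (G : topGroupType) (phi : G -> G)
    (N : normalSubgroup G) (tdlcG : tdlc G) (phi_aut : top_automorphism phi)
    (N_closed : closed (nsg_set N)) (phiN : phi @` nsg_set N = nsg_set N) :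
  ((forall U : set G, open_compact_subgroup U ->
      (\val : subgroupT N -> G) @`
        cotraj (restr phiN) ((\val : subgroupT N -> G) @^-1` U) =
      cotraj phi U `&` nsg_set N) /\
   (h_top R (restr phiN) <= h_top R phi)%E) /\
  ((forall U : set G, open_compact_subgroup U -> nsg_set N `<=` U ->
      cotraj (@quot_map G N phi) (quot_proj N @` U) =
      quot_proj N @` cotraj phi U) /\
   (h_top R (@quot_map G N phi) <= h_top R phi)%E).
Proof.
have [phiM _ _] := phi_aut.
split; split.
- by move=> U _; exact: cotraj_restr.
- exact: h_top_restr_le.
- by move=> U [sU _ _] NU; exact: cotraj_quot.
- exact: h_top_quot_le.
Qed.
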